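(* Let $n\ge1$, $K>1$, $0<T_1<T$ and $0<\delta<1$. There exist constants $\kappa,\mu>0$, depending only on $n,\delta,T_1,T,K$, such that if $u$ is a viscosity solution of $$\begin{cases}\partial_tu-\mathcal M_K^-(D^2u)\ge-\kappa & \text{in } B_1\times(0,T],\\ u(x,0)\ge1 & \text{for } |x|\le\delta,\\ u\ge0 & \text{on } \partial_p(B_1\times(0,T]),\end{cases}$$ then $$u(x,t)\ge\mu\,\operatorname{dist}(x,\partial B_1)\quad\text{in } B_1\times[T_1,T].$$
   Context: $B_1$ is the open unit ball of $\mathbb R^n$ centered at the origin. $\mathcal M_K^-$ is the extremal Pucci operator $\mathcal M_K^-(N)=\inf_{K^{-1}I\le A\le KI}\operatorname{tr}(AN)$ for symmetric $n\times n$ matrices $N$ (infimum over symmetric matrices $A$). The parabolic boundary is $\partial_p(B_1\times(0,T])=(B_1\times\{0\})\cup(\partial B_1\times[0,T])$. $D^2u$ is the Hessian in $x$. The differential inequality $\partial_tu-\mathcal M_K^-(D^2u)\ge-\kappa$ is understood in the usual parabolic viscosity (supersolution) sense. *)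

(* Defs.v *)
From HB Require Import structures.
From mathcomp Require Import all_boot all_order all_algebra.
From mathcomp Require Import all_classical all_reals all_analysis.
Import Order.TTheory GRing.Theory Num.Theory.
Import numFieldNormedType.Exports.

Set Implicit Arguments.
Unset Strict Implicit.
Unset Printing Implicit Defensive.

Local Open Scope classical_set_scope.
Local Open Scope ring_scope.

(* Points of R^n are row vectors and points of space-time are pairs (x, t).
   The library norm on 'rV[R]_n is the sup norm, so the Euclidean norm is
   defined here; the two norms induce the same topology. *)

Definition euclid_norm (R : realType) (n : nat) (x : 'rV[R]_n) : R :=
  Num.sqrt (\sum_(i < n) x 0 i ^+ 2).

Definition euclid_ball1 (R : realType) (n : nat) : set 'rV[R]_n :=
  [set x | euclid_norm x < 1].

Definition euclid_sphere1 (R : realType) (n : nat) : set 'rV[R]_n :=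
  [set x | euclid_norm x = 1].

Definition euclid_dist (R : realType) (n : nat) (x : 'rV[R]_n) (A : set 'rV[R]_n)
    : R :=
  inf [set euclid_norm (x - y) | y in A].

Definition para_cylinder (R : realType) (n : nat) (T : R) : set ('rV[R]_n * R) :=
  @euclid_ball1 R n `*` [set t | 0 < t <= T].

Definition parabolic_boundary (R : realType) (n : nat) (T : R)
    : set ('rV[R]_n * R) :=
  (@euclid_ball1 R n `*` [set 0]) `|` (@euclid_sphere1 R n `*` [set t | 0 <= t <= T]).

Definition psdmx (R : realType) (n : nat) (A : 'M[R]_n) : Prop :=
  A^T = A /\ forall v : 'rV[R]_n, 0 <= (v *m A *m v^T) 0 0.

Definition loewner_le (R : realType) (n : nat) (A B : 'M[R]_n) : Prop :=
  psdmx (B - A).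

Definition pucci_minus (R : realType) (n : nat) (K : R) (N : 'M[R]_n) : R :=
  inf [set \tr (A *m N) | A in
        [set A : 'M[R]_n |
          [/\ A^T = A, loewner_le (K^-1)%:M A & loewner_le A K%:M]]].

Definition time_dir (R : realType) (n : nat) : 'rV[R]_n * R := (0, 1).

Definition space_dir (R : realType) (n : nat) (i : 'I_n) : 'rV[R]_n * R :=
  (delta_mx 0 i, 0).

Definition hessian (R : realType) (n : nat) (phi : 'rV[R]_n * R -> R)
    (p : 'rV[R]_n * R) : 'M[R]_n :=
  \matrix_(i < n, j < n)
    'D_(space_dir R i) (fun q => 'D_(space_dir R j) phi q) p.

(* phi is C^1 in t and C^2 in x on some neighbourhood of p. *)
Definition C21_near (R : realType) (n : nat) (phi : 'rV[R]_n * R -> R)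
    (p : 'rV[R]_n * R) : Prop :=
  \forall q \near p,
    [/\ {for q, continuous phi},
        derivable phi q (time_dir R n) /\
          {for q, continuous (fun z => 'D_(time_dir R n) phi z)},
        forall i : 'I_n, derivable phi q (space_dir R i) /\
          {for q, continuous (fun z => 'D_(space_dir R i) phi z)}
      & forall i j : 'I_n,
          derivable (fun z => 'D_(space_dir R j) phi z) q (space_dir R i) /\
          {for q, continuous (fun z => hessian phi z i j)}].

(* Viscosity sense of  d_t u - M_K^-(D^2 u) >= - kappa  in B_1 x (0, T].
   Lower semicontinuity is required on the closed para_cylinder, so that the data
   on the parabolic boundary are linked to u inside; u is irrelevant elsewhere.
   Minima are relative to B_1 x (0, T], hence one-sided in time at t = T. *)
Definition viscosity_supersolution (R : realType) (n : nat) (K T kappa : R)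
    (u : 'rV[R]_n * R -> R) : Prop :=
  lower_semicontinuous
    (EFin \o u : subspace (para_cylinder T `|` parabolic_boundary T) -> \bar R) /\
  forall (p : 'rV[R]_n * R) (phi : 'rV[R]_n * R -> R),
    para_cylinder T p ->
    C21_near phi p ->
    (\forall q \near within (para_cylinder T) (nbhs p),
        u p - phi p <= u q - phi q) ->
    - kappa <= 'D_(time_dir R n) phi p - pucci_minus K (hessian phi p).

(* Main.v *)
Require Import Defs.
From HB Require Import structures.
From mathcomp Require Import all_boot all_order all_algebra.
From mathcomp Require Import all_classical all_reals all_analysis.
From mathcomp Require Import ring lra.
Import Order.TTheory GRing.Theory Num.Theory.
Import numFieldNormedType.Exports.
Local Open Scope classical_set_scope.
Local Open Scope ring_scope.

(** A supersolution [u] stays above every smooth strict subsolution that lies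
    below it on the parabolic boundary, because a negative minimum of
    [u - phi] over the closed cylinder would be a contact point contradicting
    the viscosity inequality ([comparison]).  The theorem therefore amounts to
    exhibiting one explicit subsolution, namely
      [phi (x, t) = e^(- l t) (e^(- a |x|^2) - e^(- a b(t)))],
    whose positivity set is the expanding ball [|x|^2 < b(t)].  The function
    [b] is [C^1], grows from [delta^2] at [t = 0] to [1] at [t = T1] and then
    stays equal to [1].  So [phi] starts below the initial data, is
    nonpositive on the lateral boundary, and for [t >= T1] vanishes there with
    a nonzero slope, which is the linear lower bound ([expR_sqr_slope]).

    The Hessian of [phi] is a positive multiple of [4 a^2 x^T x - 2 a I].
    Away from the origin, [|x|^2 >= delta^2 / 2], a large [a] makes the rank
    one part dominate the Pucci operator, with enough room to pay for the
    motion of the front [b].  Near the origin [phi] is bounded below by a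
    positive multiple of [e^(- l t)], and a large decay rate [l] takes over.
    This is [barrier_strict].

    The factor [e^(- l t)] has the wrong sign where [phi < 0], and far outside
    the front [phi] is not a subsolution.  That region is avoided: comparing
    [u] with [- 2 kappa t] first gives [u >= - 2 kappa T], so the differential
    inequality for [phi] matters only where [phi > - 2 kappa T], and there
    [e^(- a b(t))] exceeds [e^(- a |x|^2)] by at most a multiple of [kappa].
    Choosing [kappa] last makes this error harmless. *)

(** * Minima of lower semicontinuous functions *)

(** If no point of [A] is a minimum, every point has a neighbourhood on which
    [f] exceeds the value at some point of [A].  Near-covering for the filter
    of sublevel sets makes this uniform over [A], so that some [q] in [A]
    satisfies [f q < f q]. *)
Lemma compact_lsc_has_min (X : topologicalType) (R : realType) (A : set X)
    (f : X -> R) :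
  compact A -> A !=set0 ->
  (forall x a, A x -> a < f x -> \forall y \near within A (nbhs x), a < f y) ->
  exists2 x, A x & forall y, A y -> f x <= f y.
Proof.
move=> /compact_near_coveringP cA [x0 Ax0] lscf; apply: contrapT => nomin.
have below x : A x -> exists2 y, A y & f y < f x.
  move=> Ax; apply: contrapT => noy; apply: nomin; exists x => // y Ay.
  by rewrite leNgt; apply/negP => fyx; apply: noy; exists y.
pose sublevel q := [set y | A y /\ f y <= f q].
pose F := filter_from A sublevel.
have FF : Filter F.
  apply: filter_from_filter; first by exists x0.
  move=> i j Ai Aj; have [fij|fji] := leP (f i) (f j).
    exists i => // y [Ay yi]; split; split => //; exact: le_trans yi fij.
  exists j => // y [Ay yj]; split; split => //; exact: le_trans yj (ltW fji).
have : \forall q \near F, A `<=` (fun x => A x -> f q < f x).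
  apply: cA => x Ax; have [y Ay yx] := below x Ax.
  have Vx := lscf x (f y) Ax yx; rewrite near_withinE in Vx.
  exists ([set z | A z -> f y < f z], sublevel y).
    by split => //; exists y.
  move=> [z q] [/= zV [Aq qy]] Az; exact: le_lt_trans qy (zV Az).
case=> q Aq /(_ q) sub.
by have := sub (conj Aq (lexx _)) q Aq Aq; rewrite ltxx.
Qed.

(** * Euclidean geometry of the ball *)

Section Euclid.
Context {R : realType} {n : nat}.
Implicit Types x y : 'rV[R]_n.

Definition sqnorm x : R := \sum_(i < n) x 0 i ^+ 2.

Lemma sqnorm_ge0 x : 0 <= sqnorm x.
Proof. by apply: sumr_ge0 => i _; exact: sqr_ge0. Qed.

Lemma sqr_euclid_norm x : euclid_norm x ^+ 2 = sqnorm x.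
Proof. by rewrite sqr_sqrtr ?sqnorm_ge0. Qed.

Lemma euclid_norm_ge0 x : 0 <= euclid_norm x.
Proof. exact: sqrtr_ge0. Qed.

Lemma euclid_norm_le1 x : (euclid_norm x <= 1) = (sqnorm x <= 1).
Proof.
rewrite -sqr_euclid_norm -[X in _ = (_ <= X)](expr1n _ 2).
by rewrite ler_pXn2r ?nnegrE ?euclid_norm_ge0.
Qed.

Lemma euclid_normZ (c : R) x : euclid_norm (c *: x) = `|c| * euclid_norm x.
Proof.
rewrite /euclid_norm -sqrtr_sqr -sqrtrM ?sqr_ge0// mulr_sumr; congr Num.sqrt.
by apply: eq_bigr => i _; rewrite mxE exprMn.
Qed.

Lemma continuous_sqnorm : continuous sqnorm.
Proof.
apply: (continuous_big (op := +%R)) => [|i _ x]; first exact: add_continuous.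
have ci : (fun y : 'rV[R]_n => y 0 i) @ x --> x 0 i.
  exact: (@coord_continuous R 1 n 0 i x).
exact: (cvgM ci ci).
Qed.

Lemma compact_sqnorm_le (r : R) : compact [set x | sqnorm x <= r].
Proof.
apply: bounded_closed_compact.
  exists (`|r| + 1); split; first by rewrite realE addr_ge0.
  move=> M rM x /= xr.
  have M0 : 0 <= M by rewrite (le_trans _ (ltW rM))// addr_ge0.
  have M1 : 1 <= M by rewrite (le_trans _ (ltW rM))// lerDr.
  rewrite /Num.norm/= mx_normrE; apply: bigmax_le => //= -[i j] _ /=.
  rewrite (ord1 i) -(ler_pXn2r (ltn0Sn 1)) ?nnegrE//= real_normK ?num_real//.
  apply: (@le_trans _ _ (sqnorm x)).
    by rewrite /sqnorm (bigD1 j)//= lerDl sumr_ge0// => k _; exact: sqr_ge0.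
  apply: (le_trans xr); apply: (le_trans (ler_norm r)).
  rewrite expr2 -[leLHS]mul1r ler_pM// (le_trans _ (ltW rM))// lerDl.
  exact: ler01.
apply: (@closed_comp _ _ sqnorm [set s | s <= r]); last exact: closed_le.
by move=> x _; exact: continuous_sqnorm.
Qed.

(** The radial projection [x / |x|] realises the bound; at the origin any point
    of the sphere does, and its existence is where [n >= 1] enters. *)
Lemma euclid_dist_sphere_le x :
  (1 <= n)%N -> euclid_ball1 x ->
  euclid_dist x (@euclid_sphere1 R n) <= 1 - euclid_norm x.
Proof.
move=> n0 x1; have [y sy <-] : exists2 y, euclid_sphere1 y &
    euclid_norm (x - y) = 1 - euclid_norm x; last first.
  apply: ge_inf; last by exists y.
  by exists 0 => _ [z _ <-]; exact: euclid_norm_ge0.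
have [x0|xN0] := eqVneq (euclid_norm x) 0.
  have unit1 : euclid_norm (delta_mx 0 (Ordinal n0) : 'rV[R]_n) = 1.
    rewrite /euclid_norm (bigD1 (Ordinal n0))//= big1 => [|i /negbTE iN]; last first.
      by rewrite mxE iN andbF expr0n.
    by rewrite mxE !eqxx expr1n addr0 sqrtr1.
  have xE : x = 0.
    apply/rowP => i; have := sqr_euclid_norm x; rewrite x0 expr0n /= => /esym/eqP.
    rewrite psumr_eq0; last by move=> j _; exact: sqr_ge0.
    by move=> /allP/(_ i)/(_ (mem_index_enum _)); rewrite sqrf_eq0 mxE => /eqP.
  exists (delta_mx 0 (Ordinal n0)) => //.
  by rewrite x0 subr0 xE sub0r -scaleN1r euclid_normZ normrN1 mul1r.
have xpos : 0 < euclid_norm x by rewrite lt_neqAle eq_sym xN0 euclid_norm_ge0.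
exists ((euclid_norm x)^-1 *: x).
  by rewrite /euclid_sphere1/= euclid_normZ ger0_norm ?invr_ge0 ?euclid_norm_ge0// mulVf.
rewrite -[X in euclid_norm (X - _)]scale1r -scalerBl euclid_normZ ler0_norm.
  by rewrite opprB mulrBl mulVf ?mul1r.
by rewrite subr_le0 invf_ge1 ?ltW.
Qed.

End Euclid.

(** * Comparison with smooth strict subsolutions *)

Section Comparison.
Context {R : realType} {n : nat} (T : R).
Hypothesis T0 : 0 < T.

Let closed_cylinder := para_cylinder (n := n) T `|` parabolic_boundary T.

Lemma closed_cylinderE :
  closed_cylinder = [set x | sqnorm x <= 1] `*` [set` `[0, T]].
Proof.
apply/seteqP; split => [[x t]|[x t] [/=]].
  case=> [[/= x1 /andP[t0 tT]]|[[/= x1 ->]|[/= x1 /andP[t0 tT]]]];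
    split; rewrite /= ?in_itv/= -?euclid_norm_le1 ?lexx ?(ltW T0) ?(ltW t0);
    rewrite ?t0 ?tT ?(ltW x1)//.
  by rewrite x1.
rewrite -euclid_norm_le1 le_eqVlt in_itv/= => /orP[/eqP x1 tT|x1 /andP[]].
  by right; right.
rewrite le_eqVlt => /orP[/eqP <-|t0] tT; first by right; left.
by left; split => //=; rewrite t0.
Qed.

Lemma compact_closed_cylinder : compact closed_cylinder.
Proof.
rewrite closed_cylinderE; apply: compact_setX; first exact: compact_sqnorm_le.
exact: segment_compact.
Qed.

(** The minimum of [u - phi] over the closed cylinder is attained.  At a point
    of the parabolic boundary, or where [phi <= u] is already known, it is
    nonnegative; elsewhere [phi] is an admissible test function and strictness
    is contradicted.  The alternative in the last hypothesis is what allows a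
    preliminary lower bound on [u] to restrict the region where [phi] has to be
    a subsolution. *)
Lemma comparison (K kappa : R) (u phi : 'rV[R]_n * R -> R) :
  viscosity_supersolution K T kappa u ->
  (forall p, C21_near phi p) ->
  (forall p, parabolic_boundary T p -> phi p <= u p) ->
  (forall p, para_cylinder T p -> phi p <= u p \/
     'D_(time_dir R n) phi p - pucci_minus K (hessian phi p) < - kappa) ->
  forall p, para_cylinder T p -> phi p <= u p.
Proof.
move=> [lscu visc] C21 bdry strict p0 Dp0.
have cphi p : {for p, continuous phi} by have /nbhs_singleton[] := C21 p.
have [p Ap pmin] : exists2 p, closed_cylinder p &
    forall q, closed_cylinder q -> u p - phi p <= u q - phi q.
  apply: compact_lsc_has_min; first exact: compact_closed_cylinder.
    by exists p0; left.
  move=> p a Ap aup; pose e := (u p - phi p - a) / 2.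
  have e0 : 0 < e by rewrite divr_gt0// subr_gt0.
  have [V] := lscu p (u p - e) ltac:(rewrite lte_fin; lra).
  rewrite /nbhs/= -nbhs_subspace_in// => Vp uV.
  have phip : \forall q \near within closed_cylinder (nbhs p), phi q < phi p + e.
    have : \forall q \near p, phi q < phi p + e.
      by have /cvgr_lt := cphi p; apply; rewrite ltrDl.
    exact: cvg_within.
  apply: filterS2 Vp phip => q /uV; rewrite lte_fin /e; lra.
apply: le_trans (_ : phi p0 + (u p - phi p) <= _); last first.
  by have := pmin p0 (or_introl Dp0); lra.
rewrite lerDl subr_ge0.
case: Ap => [Dp|]; last exact: bdry.
case: (strict p Dp) => // lt_kappa.
have pmin_near : \forall q \near within (para_cylinder T) (nbhs p),
    u p - phi p <= u q - phi q.
  by rewrite near_withinE; apply: nearW => q Dq; apply: pmin; left.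
by have := visc p phi Dp (C21 p) pmin_near; rewrite leNgt lt_kappa.
Qed.

End Comparison.

(** * A lower bound for the Pucci operator *)

Section Pucci.
Context {R : realType} {n : nat}.

Lemma scalar_mx_form (c : R) (x : 'rV[R]_n) :
  (x *m c%:M *m x^T) 0 0 = c * sqnorm x.
Proof.
rewrite mul_mx_scalar -scalemxAl !mxE; congr (_ * _).
by apply: eq_bigr => i _; rewrite mxE expr2.
Qed.

Lemma psdmx_scalar (c : R) : 0 <= c -> psdmx (c%:M : 'M[R]_n).
Proof.
move=> c0; split => [|v]; first exact: tr_scalar_mx.
by rewrite scalar_mx_form mulr_ge0// sqnorm_ge0.
Qed.

Lemma psdmx_trace_ge0 (A : 'M[R]_n) : psdmx A -> 0 <= \tr A.
Proof.
move=> [_ Apos]; apply: sumr_ge0 => i _.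
have := Apos (delta_mx 0 i).
by rewrite -rowE !mxE (bigD1 i)//= big1 ?mxE ?eqxx ?mulr1 ?addr0// => j /negbTE jN;
  rewrite !mxE jN andbF mulr0.
Qed.

(** Radial Hessians have the form [p x^T x - q I].  For every admissible [A] one
    has [tr (A x^T x) = x A x^T >= |x|^2 / K] and [tr A <= K n]; testing the
    Loewner inequalities on [x] and on the unit vectors suffices, so no
    eigenvalues are involved. *)
Lemma pucci_minus_ge (K p q : R) (x : 'rV[R]_n) : 1 <= K -> 0 <= p -> 0 <= q ->
  K^-1 * p * sqnorm x - q * (K * n%:R) <= pucci_minus K (p *: (x^T *m x) - q%:M).
Proof.
move=> K1 p0 q0; have K0 : 0 < K := lt_le_trans ltr01 K1.
apply: lb_le_inf.
  exists (\tr (1%:M *m (p *: (x^T *m x) - q%:M))), 1%:M => //; split.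
  - exact: tr_scalar_mx.
  - rewrite /loewner_le -raddfB; apply: psdmx_scalar.
    by rewrite subr_ge0 invf_le1.
  - by rewrite /loewner_le -raddfB; apply: psdmx_scalar; rewrite subr_ge0.
move=> _ [A [_ [_ AK] KA] <-].
rewrite mulmxBr mxtraceD -scalemxAr mxtraceZ mulmxA mxtrace_mulC mulmxA.
rewrite [\tr (_ *m x^T)]trace_mx11 mul_mx_scalar raddfN/= mxtraceZ.
apply: lerB.
  rewrite [_ * p]mulrC -mulrA ler_wpM2l// -subr_ge0 -scalar_mx_form.
  by have := AK x; rewrite mulmxBr mulmxBl !mxE.
rewrite ler_wpM2l// -subr_ge0.
have := psdmx_trace_ge0 _ KA.
by rewrite raddfB/= mxtrace_scalar mulr_natr.
Qed.

End Pucci.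

(** * Test functions that are Gaussian in space *)

Section Derivatives.
Context {R : realType}.

(** Reduces directional derivatives in space-time to derivatives of functions
    of one real variable. *)
Lemma is_derive_along (V : normedModType R) (f : V -> R) (p v : V) (d : R) :
  is_derive (0 : R) 1 (fun h => f (h *: v + p)) d <-> is_derive p v f d.
Proof.
have E : (fun h : R => h^-1 *: (((fun h => f (h *: v + p)) \o shift 0) (h *: 1) -
      f (0 *: v + p))) = (fun h => h^-1 *: ((f \o shift p) (h *: v) - f p)).
  by apply/funext => h /=; rewrite addr0 scale0r add0r /GRing.scale/= mulr1.
by split => -[df Df]; split; move: df Df; rewrite /derivable /derive E.
Qed.

Context {n : nat}.

Lemma sqnorm_line (x : 'rV[R]_n) (i : 'I_n) (h : R) :
  sqnorm (h *: delta_mx 0 i + x) = sqnorm x + 2 * h * x 0 i + h ^+ 2.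
Proof.
rewrite /sqnorm (bigD1 i)//= [in RHS](bigD1 i)//= !mxE !eqxx.
under eq_bigr => j /negbTE jN do rewrite !mxE jN andbF mulr0 add0r.
rewrite mulr1; ring.
Qed.

(** Contains both comparison functions of the proof: the barrier, and the
    function [- 2 kappa t], for which [a] and [al] vanish. *)
Definition radial (a : R) (al ga : R -> R) (p : 'rV[R]_n * R) : R :=
  al p.2 * expR (- a * sqnorm p.1) + ga p.2.

Variable a : R.
Context {al dal ga dga : R -> R}.
Local Notation phi := (radial a al ga).
Hypothesis al_dal : forall t : R, is_derive t (1 : R) al (dal t).
Hypothesis ga_dga : forall t : R, is_derive t (1 : R) ga (dga t).
Hypothesis cdal : continuous dal.
Hypothesis cdga : continuous dga.

Lemma is_derive_radial_time p :
  is_derive p (time_dir R n) phi (dal p.2 * expR (- a * sqnorm p.1) + dga p.2).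
Proof.
apply/is_derive_along; case: p => x t /=.
have -> : (fun h => phi (h *: time_dir R n + (x, t))) = (fun h =>
    al (h *: (1 : R) + t) * expR (- a * sqnorm x) + ga (h *: (1 : R) + t)).
  by apply/funext => h; rewrite /radial/= scaler0 add0r.
have /is_derive_along Dal := al_dal t.
have /is_derive_along Dga := ga_dga t.
apply: is_derive_eq.
by rewrite scaler0 add0r; congr (_ + _); exact: mulrC.
Qed.

Lemma is_derive_radial_space p i :
  is_derive p (space_dir R i) phi
    (- 2 * a * p.1 0 i * (al p.2 * expR (- a * sqnorm p.1))).
Proof.
apply/is_derive_along; case: p => x t /=.
have -> : (fun h => phi (h *: space_dir R i + (x, t))) = (fun h =>
    al t * expR (- a * (sqnorm x + 2 * h * x 0 i + h ^+ 2)) + ga t).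
  by apply/funext => h; rewrite /radial/= scaler0 add0r sqnorm_line.
apply: is_derive_eq.
rewrite /GRing.scale/= !(mulr0, mul0r, addr0, expr0n)/=; ring.
Qed.

Lemma is_derive_radial_space2 p i j :
  is_derive p (space_dir R i)
    (fun q : 'rV[R]_n * R => - 2 * a * q.1 0 j * (al q.2 * expR (- a * sqnorm q.1)))
    ((4 * a ^+ 2 * (p.1 0 i * p.1 0 j) - 2 * a * (i == j)%:R) *
       (al p.2 * expR (- a * sqnorm p.1))).
Proof.
apply/is_derive_along; case: p => x t /=.
have -> : (fun h : R => - 2 * a * (h *: space_dir R i + (x, t)).1 0 j *
      (al (h *: space_dir R i + (x, t)).2 *
       expR (- a * sqnorm (h *: space_dir R i + (x, t)).1))) = (fun h =>
    - 2 * a * (h * (i == j)%:R + x 0 j) *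
      (al t * expR (- a * (sqnorm x + 2 * h * x 0 i + h ^+ 2)))).
  apply/funext => h; rewrite /= scaler0 add0r sqnorm_line !mxE eqxx/=.
  by rewrite [j == i]eq_sym.
apply: is_derive_eq.
rewrite /GRing.scale/= !(mulr0, mul0r, addr0, expr0n)/=; ring.
Qed.

Lemma derive_radial_time :
  (fun z => 'D_(time_dir R n) phi z) =
  (fun p : 'rV[R]_n * R => dal p.2 * expR (- a * sqnorm p.1) + dga p.2).
Proof. by apply/funext => p; have [] := is_derive_radial_time p. Qed.

Lemma derive_radial_space i :
  (fun z => 'D_(space_dir R i) phi z) =
  (fun p : 'rV[R]_n * R => - 2 * a * p.1 0 i * (al p.2 * expR (- a * sqnorm p.1))).
Proof. by apply/funext => p; have [] := is_derive_radial_space p i. Qed.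

Lemma hessian_radialE p i j : hessian phi p i j =
  (4 * a ^+ 2 * (p.1 0 i * p.1 0 j) - 2 * a * (i == j)%:R) *
    (al p.2 * expR (- a * sqnorm p.1)).
Proof.
by rewrite mxE derive_radial_space; have [] := is_derive_radial_space2 p i j.
Qed.

Lemma hessian_radial p : let w := al p.2 * expR (- a * sqnorm p.1) in
  hessian phi p = (4 * a ^+ 2 * w) *: (p.1^T *m p.1) - (2 * a * w)%:M.
Proof.
move=> w; apply/matrixP => i j; rewrite hessian_radialE -/w !mxE big_ord1 !mxE.
rewrite -mulr_natr; ring.
Qed.

Lemma C21_radial p : C21_near phi p.
Proof.
have cexp : continuous (fun q : 'rV[R]_n * R => expR (- a * sqnorm q.1)).
  move=> q; apply: continuous_comp; last exact: continuous_expR.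
  apply: cvgM; first exact: cvg_cst.
  by apply: continuous_comp; [exact: cvg_fst | exact: continuous_sqnorm].
have snd_cont (f : R -> R) :
    continuous f -> continuous (fun q : 'rV[R]_n * R => f q.2).
  by move=> cf q; apply: continuous_comp; [exact: cvg_snd | exact: cf].
have derive_cont (f df : R -> R) : (forall t : R, is_derive t (1 : R) f (df t)) -> continuous f.
  move=> Df t; apply: differentiable_continuous; apply/derivable1_diffP.
  by have [] := Df t.
have cal := snd_cont al (derive_cont _ _ al_dal).
have cga := snd_cont ga (derive_cont _ _ ga_dga).
have coord_cont i : continuous (fun q : 'rV[R]_n * R => q.1 0 i).
  move=> q; apply: (continuous_comp (g := fun y : 'rV[R]_n => y 0 i)).
    exact: cvg_fst.
  exact: (@coord_continuous R 1 n 0 i q.1).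
apply: (@filterE _ (nbhs p)) => q; split.
- by apply: cvgD; [apply: cvgM; [exact: cal|exact: cexp]|exact: cga].
- split; first by have [] := is_derive_radial_time q.
  rewrite derive_radial_time.
  apply: cvgD; last exact: snd_cont.
  by apply: cvgM; [exact: snd_cont | exact: cexp].
- move=> i; split; first by have [] := is_derive_radial_space q i.
  rewrite derive_radial_space.
  apply: cvgM; last by apply: cvgM; [exact: cal|exact: cexp].
  by apply: cvgM; [exact: cvg_cst|exact: coord_cont].
- move=> i j; split.
    by rewrite derive_radial_space; have [] := is_derive_radial_space2 q i j.
  have -> : (fun z => hessian phi z i j) = (fun p =>
      (4 * a ^+ 2 * (p.1 0 i * p.1 0 j) - 2 * a * (i == j)%:R) *
        (al p.2 * expR (- a * sqnorm p.1))).
    by apply/funext => z; exact: hessian_radialE.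
  apply: cvgM; last by apply: cvgM; [exact: cal|exact: cexp].
  apply: cvgB; last exact: cvg_cst.
  apply: cvgM; first exact: cvg_cst.
  by apply: cvgM; exact: coord_cont.
Qed.

Lemma radial_operator_le K p : 1 <= K -> 0 <= a -> 0 <= al p.2 ->
  'D_(time_dir R n) phi p - pucci_minus K (hessian phi p) <=
  dal p.2 * expR (- a * sqnorm p.1) + dga p.2 -
  al p.2 * expR (- a * sqnorm p.1) *
    (K^-1 * (4 * a ^+ 2) * sqnorm p.1 - 2 * a * (K * n%:R)).
Proof.
move=> K1 a0 al0; have w0 : 0 <= al p.2 * expR (- a * sqnorm p.1).
  by rewrite mulr_ge0// expR_ge0.
have [_ ->] := is_derive_radial_time p.
rewrite hessian_radial; apply: lerB => //.
set w := al p.2 * _ in w0 *.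
have w1 : 0 <= 4 * a ^+ 2 * w by rewrite !mulr_ge0// sqr_ge0.
have w2 : 0 <= 2 * a * w by rewrite !mulr_ge0.
apply: le_trans (pucci_minus_ge K _ _ p.1 K1 w1 w2).
by rewrite le_eqVlt; apply/orP; left; apply/eqP; ring.
Qed.

End Derivatives.

(** * The moving front *)

Section PositivePart.
Context {R : realType}.

Definition pospart (t : R) : R := Num.max 0 t.

Lemma pospart_ge0 t : 0 <= pospart t.
Proof. by rewrite le_max lexx. Qed.

Lemma continuous_pospart : continuous pospart.
Proof.
by move=> t; apply: continuous_max; [exact: cvg_cst | exact: cvg_id].
Qed.

Lemma pospart_sqr_taylor (t h : R) :
  `|pospart (h + t) ^+ 2 - pospart t ^+ 2 - 2 * pospart t * h| <= h ^+ 2.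
Proof.
rewrite ler_norml /pospart.
by have [t0|t0] := leP 0 t; have [h0|h0] := leP 0 (h + t); apply/andP; split; nra.
Qed.

(** The second order Taylor estimate gives the derivative also at the junction
    [t = 0], without a case distinction. *)
Lemma is_derive_pospart_sqr (t : R) :
  is_derive t (1 : R) (fun s => pospart s ^+ 2) (2 * pospart t).
Proof.
have D : h^-1 *: (((fun s : R => pospart s ^+ 2) \o shift t) (h *: (1 : R)) -
    pospart t ^+ 2) @[h --> 0^'] --> 2 * pospart t.
  apply/cvgrPdist_le => e e0; near=> h.
  have hN0 : h != 0 by near: h; exact: nbhs_dnbhs_neq.
  rewrite /= /GRing.scale/= mulr1 distrC.
  rewrite [X in `|X|](_ : _ = h^-1 *
    (pospart (h + t) ^+ 2 - pospart t ^+ 2 - 2 * pospart t * h)); last by field.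
  rewrite normrM normfV mulrC ler_pdivrMr ?normr_gt0//.
  apply: le_trans (pospart_sqr_taylor _ _) _.
  rewrite -real_normK ?num_real// expr2 ler_wpM2r//.
  by near: h; apply: dnbhs0_le.
by split; [apply: cvgP D | apply: cvg_lim D].
Unshelve. all: by end_near. Qed.

End PositivePart.

Section Front.
Context {R : realType}.
Variables (T1 d : R).
Hypothesis T10 : 0 < T1.
Hypothesis d0 : 0 < d.
Hypothesis d1 : d < 1.

(** The squared radius of the positivity set of the barrier.  The squared
    positive part is the simplest profile that reaches [1] at time [T1], is
    constant afterwards, and is [C^1] as test functions require. *)
Definition front (t : R) : R := 1 - (1 - d) * pospart (1 - t / T1) ^+ 2.
Definition dfront (t : R) : R := 2 * (1 - d) / T1 * pospart (1 - t / T1).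

Lemma is_derive_front t : is_derive t (1 : R) front (dfront t).
Proof.
have D1 : is_derive t (1 : R) (fun t => 1 - t / T1) (- T1^-1).
  by apply: is_derive_eq; rewrite /GRing.scale/=; ring.
have D2 := is_derive1_comp (is_derive_pospart_sqr (1 - t / T1))
  (g := fun t => 1 - t / T1) D1.
rewrite /front; apply: is_derive_eq.
rewrite /dfront /GRing.scale/=; ring.
Qed.

Lemma continuous_dfront : continuous dfront.
Proof.
move=> t; apply: cvgM; first exact: cvg_cst.
apply: (continuous_comp (f := fun s : R => 1 - s / T1)).
  2: exact: continuous_pospart.
by apply: cvgB; [exact: cvg_cst|apply: cvgM; [exact: cvg_id|exact: cvg_cst]].
Qed.

Let pospart_bounds t : 0 <= t -> 0 <= pospart (1 - t / T1) <= 1.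
Proof.
by move=> t0; rewrite pospart_ge0 ge_max ler01/= gerBl divr_ge0// ltW.
Qed.

Lemma front_bounds t : 0 <= t -> d <= front t <= 1.
Proof.
move=> /pospart_bounds/andP[p0 p1]; have [d_gt0 d_lt1] := (d0, d1).
have p2 : pospart (1 - t / T1) ^+ 2 <= 1 by rewrite expr_le1.
have p20 := sqr_ge0 (pospart (1 - t / T1)).
by rewrite /front; apply/andP; split; nra.
Qed.

Lemma dfront_bounds t : 0 <= t -> 0 <= dfront t <= 2 / T1.
Proof.
move=> /pospart_bounds/andP[p0 p1]; have [d_gt0 d_lt1] := (d0, d1).
have -> : dfront t = 2 / T1 * ((1 - d) * pospart (1 - t / T1)).
  by rewrite /dfront; ring.
have v0 : 0 <= 2 / T1 by rewrite divr_ge0// ltW.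
apply/andP; split; first by rewrite mulr_ge0//; nra.
by rewrite ler_piMr//; nra.
Qed.

Lemma front_eq1 t : T1 <= t -> front t = 1.
Proof.
move=> tT; rewrite /front /pospart max_l ?expr0n ?mulr0 ?subr0//.
by rewrite subr_le0 ler_pdivlMr// mul1r.
Qed.

Lemma front0 : front 0 = d.
Proof. by rewrite /front /pospart mul0r subr0 max_r// expr1n; ring. Qed.

End Front.

(** * The differential inequality for the barrier *)

Section BarrierConstants.
Context {R : realType}.

(** Here [N] is the dimension, [d] the initial squared radius of the front and [C]
    a bound for the speed of that squared radius.  The clauses are, in order: the rank one part
    of the Hessian beats its scalar part and the motion of the front when
    [|x|^2 >= d / 2]; the decay rate beats both when [|x|^2 <= d / 2];
    and [kappa] is small against the gain [a e^(- l T - a)] of the first region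
    and the gain [e^(- l T - a)] of the second. *)
Definition barrier_constants (K N T C d a l kappa : R) : Prop :=
  [/\ a * (C + 1) <= K^-1 * (4 * a ^+ 2) * (d / 2) - 2 * a * (K * N),
      a * C + 2 * a * (K * N) + 1 <= l * (expR (- a * (d / 2)) - expR (- a * d)),
      2 * kappa * T * (l + a * C) + kappa < a * expR (- l * T - a)
    & kappa < expR (- l * T - a)].

(** The constants are chosen one after the other: [a] turns its inequality into
    an equality, then [l] does so given [a], then [kappa] is taken small. *)
Lemma exists_barrier_constants (K N T C d : R) :
  0 < K -> 0 <= N -> 0 <= T -> 0 <= C -> 0 < d ->
  exists a l kappa : R, [/\ 0 < a, 0 < l, 0 < kappa
    & barrier_constants K N T C d a l kappa].
Proof.
move=> K0 N0 T0 C0 d0.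
have KN0 : 0 <= K * N by rewrite mulr_ge0// ltW.
have [a [a0 ha]] : exists a : R, 0 < a /\
    a * (C + 1) <= K^-1 * (4 * a ^+ 2) * (d / 2) - 2 * a * (K * N).
  exists (K * (2 * (K * N) + C + 1) / (2 * d)); split.
    by rewrite divr_gt0// mulr_gt0//; lra.
  rewrite le_eqVlt; apply/orP; left; apply/eqP; field.
  by rewrite !gt_eqF.
have aC0 : 0 <= a * C by rewrite mulr_ge0// ltW.
have aKN0 : 0 <= 2 * a * (K * N) by rewrite mulr_ge0//; lra.
set c := expR (- a * (d / 2)) - expR (- a * d).
have c0 : 0 < c.
  by rewrite subr_gt0 ltr_expR !mulNr ltrN2 ltr_pM2l// ltr_pdivrMr// ltr_pMr// ltr1n.
have [l [l0 hl]] : exists l : R, 0 < l /\ a * C + 2 * a * (K * N) + 1 <= l * c.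
  exists ((a * C + 2 * a * (K * N) + 1) / c).
  by rewrite mulfVK ?gt_eqF// lexx divr_gt0//; lra.
have eta0 := expR_gt0 (- l * T - a); set eta := expR _ in eta0.
have M0 : 0 <= 2 * T * (l + a * C) by rewrite mulr_ge0//; lra.
have ratio : a / (1 + a) < a /\ a / (1 + a) < 1.
  have a1 : 0 < 1 + a by lra.
  have aa := mulr_gt0 a0 a0.
  by split; rewrite ltr_pdivrMr//; lra.
have r0 : 0 < a / (1 + a) by rewrite divr_gt0//; lra.
have [kappa [k0 kM]] : exists kappa : R, 0 < kappa /\
    kappa * (2 * T * (l + a * C) + 2) = eta * (a / (1 + a)).
  exists (eta * (a / (1 + a)) / (2 * T * (l + a * C) + 2)).
  have D0 : 0 < 2 * T * (l + a * C) + 2 by lra.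
  split; last by rewrite mulfVK// gt_eqF.
  exact: divr_gt0 (mulr_gt0 eta0 r0) D0.
have kM0 := mulr_ge0 (ltW k0) M0.
(* The factor [a / (1 + a)] is smaller than both [a] and [1], so that one
   choice of [kappa] meets both of its upper bounds. *)
have [ra r1] := ratio.
have ea : eta * (a / (1 + a)) < eta * a by rewrite ltr_pM2l.
have e1 : eta * (a / (1 + a)) < eta * 1 by rewrite ltr_pM2l.
by exists a, l, kappa; split => //; split => //; rewrite -/eta; lra.
Qed.

(** The left-hand side is the bound of [radial_operator_le] for the barrier,
    with [s = |x|^2], [B = e^(- a b(t))] and [b'] the speed of the front.  The
    assumption [- 2 kappa T < w - al B] bounds [al B] by [w + 2 kappa T],
    which allows the terms in [al B] to be absorbed by the Hessian term, a
    multiple of [w]. *)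
Lemma barrier_strict (K N T C d a l kappa al B b' s t : R) :
  0 < K -> 0 <= N -> 0 < a -> 0 < l -> 0 < kappa ->
  barrier_constants K N T C d a l kappa ->
  0 <= s <= 1 -> 0 <= t <= T -> al = expR (- l * t) ->
  0 < B <= expR (- a * d) -> 0 <= b' <= C -> 0 < d ->
  let w := al * expR (- a * s) in
  - (2 * kappa * T) < w - al * B ->
  - l * w + al * B * (l + a * b')
    - w * (K^-1 * (4 * a ^+ 2) * s - 2 * a * (K * N)) < - kappa.
Proof.
move=> K0 N0 a0 l0 k0 [ha hl hk1 hk2] /andP[s0 s1] /andP[t0 tT] alE.
move=> /andP[B0 Bd] /andP[b'0 b'C] d0; set E := expR (- a * s) => w above.
have al0 : 0 < al by rewrite alE expR_gt0.
have E0 : 0 < E := expR_gt0 _.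
have w0 : 0 < w := mulr_gt0 al0 E0.
have aC0 : 0 <= a * C by rewrite mulr_ge0 ?(ltW a0)// (le_trans b'0).
have ab' : a * b' <= a * C by rewrite ler_pM2l.
have ab'0 : 0 <= a * b' by rewrite mulr_ge0// ltW.
have s_coef : 0 <= K^-1 * (4 * a ^+ 2) by rewrite !mulr_ge0 ?invr_ge0 ?sqr_ge0// ltW.
(* The Hessian term wins for [d / 2 <= s]. *)
have [sd|sd] := leP (d / 2) s.
  have wfloor : a * expR (- l * T - a) <= a * w.
    by rewrite ler_pM2l// /w alE -expRD ler_expR; nra.
  have X : w * (a * (C + 1)) <= w * (K^-1 * (4 * a ^+ 2) * s - 2 * a * (K * N)).
    by rewrite ler_pM2l// (le_trans ha)// lerB// ler_wpM2l.
  have bB : al * B * (a * b') <= (w + 2 * kappa * T) * (a * C).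
    by apply: ler_pM => //; [rewrite mulr_ge0 ?ltW | lra].
  have lB : l * (al * B - w) <= l * (2 * kappa * T) by rewrite ler_pM2l//; lra.
  lra.
(* For [s < d / 2] the decay term wins, because [E - B] has a positive lower
   bound there. *)
have E_ge : expR (- a * (d / 2)) <= E by rewrite ler_expR; nra.
have E1 : E <= 1 by rewrite /E -expR0 ler_expR; nra.
have B1 : B <= 1 by rewrite (le_trans Bd)// -expR0 ler_expR; nra.
have alfloor : expR (- l * T - a) <= al by rewrite alE ler_expR; nra.
have lE : a * C + 2 * a * (K * N) + 1 <= l * (E - B).
  by rewrite (le_trans hl)// ler_pM2l// lerB.
have bB : B * (a * b') <= a * C.
  by rewrite (le_trans _ ab')// ler_piMl.
have e1 : 0 <= E * (K^-1 * (4 * a ^+ 2) * s).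
  exact: mulr_ge0 (ltW E0) (mulr_ge0 s_coef s0).
have e2 : E * (2 * a * (K * N)) <= 2 * a * (K * N).
  by rewrite ler_piMl// !mulr_ge0// ltW.
have total : - l * E + B * (l + a * b')
    - E * (K^-1 * (4 * a ^+ 2) * s - 2 * a * (K * N)) <= - 1 by lra.
have := ler_wpM2l (ltW al0) total; rewrite /w; lra.
Qed.

End BarrierConstants.

(** Convexity of the exponential turns the difference into a multiple of
    [1 - r ^+ 2], hence of the distance [1 - r] to the sphere. *)
Lemma expR_sqr_slope {R : realType} (a r : R) : 0 <= a -> 0 <= r <= 1 ->
  expR (- a) * (a * (1 - r)) <= expR (- a * r ^+ 2) - expR (- a).
Proof.
move=> a0 /andP[r0 r1].
rewrite (_ : - a * r ^+ 2 = - a + a * (1 - r ^+ 2)); last by ring.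
rewrite expRD -{3}(mulr1 (expR (- a))) -mulrBr ler_wpM2l ?expR_ge0//.
rewrite lerBrDl; apply: le_trans (expR_ge1Dx _).
by rewrite lerD2l ler_wpM2l//; nra.
Qed.

(** * Lower bounds for supersolutions *)

(** The comparison function is [- 2 kappa t], the factor [2] making it a strict
    subsolution. *)
Lemma supersolution_ge (R : realType) (n : nat) (K T kappa : R)
    (u : 'rV[R]_n * R -> R) :
  1 <= K -> 0 < T -> 0 < kappa -> viscosity_supersolution K T kappa u ->
  (forall p, parabolic_boundary T p -> 0 <= u p) ->
  forall p, para_cylinder T p -> - (2 * kappa * T) <= u p.
Proof.
move=> K1 T0 k0 usol u_bdry p Dp; pose ga s := - (2 * kappa) * s.
have Dal (s : R) : is_derive s (1 : R) (fun=> 0 : R) 0 by exact: is_derive_cst.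
have Dga (s : R) : is_derive s (1 : R) ga (- (2 * kappa)).
  by apply: is_derive_eq; rewrite /GRing.scale/=; ring.
apply: le_trans (_ : radial 0 (fun=> 0) ga p <= _).
  by case: Dp => _ /andP[_ pT]; rewrite /radial/ga; nra.
move: p Dp; apply: (comparison _ T0 _ _ _ _ usol).
- by move=> p; apply: (C21_radial 0 Dal Dga) => ?; exact: cvg_cst.
- move=> p bp; apply: le_trans (u_bdry p bp).
  have p2 : 0 <= p.2 by case: bp => -[_ /=]; [move=> -> | case/andP].
  by rewrite /radial/ga; nra.
- move=> p Dp; right; apply: le_lt_trans.
    exact: (radial_operator_le 0 Dal Dga K p K1 (lexx _) (lexx _)).
  by rewrite !mul0r; lra.
Qed.

Theorem proposition1p2 (R : realType) (n : nat) (K T1 T delta : R)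
    (hn : (1 <= n)%N) (hK : 1 < K) (hT1 : 0 < T1) (hT : T1 < T)
    (hdelta0 : 0 < delta) (hdelta1 : delta < 1) :
  exists kappa mu : R, 0 < kappa /\ 0 < mu /\
    forall u : 'rV[R]_n * R -> R,
      viscosity_supersolution K T kappa u ->
      (forall x : 'rV[R]_n, euclid_norm x <= delta -> 1 <= u (x, 0)) ->
      (forall p : 'rV[R]_n * R, parabolic_boundary T p -> 0 <= u p) ->
      forall (x : 'rV[R]_n) (t : R),
        euclid_ball1 x -> T1 <= t <= T ->
        mu * euclid_dist x (@euclid_sphere1 R n) <= u (x, t).
Proof.
have T0 : 0 < T := lt_trans hT1 hT.
have K0 : 0 < K := lt_trans ltr01 hK.
pose d := delta ^+ 2.
have d0 : 0 < d by rewrite exprn_gt0.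
have d1 : d < 1 by rewrite exprn_ilt1// ltW.
have C0 : 0 <= 2 / T1 by rewrite divr_ge0// ltW.
have [a [l [kappa [a0 l0 k0 const]]]] :=
  exists_barrier_constants K n%:R T (2 / T1) d K0 (ler0n _ _) (ltW T0) C0 d0.
exists kappa, (a * expR (- l * T - a)); split => //.
split; first by rewrite mulr_gt0 ?expR_gt0.
move=> u usol u_init u_bdry x t x1 /andP[T1t tT].
have u_lower := supersolution_ge _ _ _ _ _ _ (ltW hK) T0 k0 usol u_bdry.
pose B s := expR (- a * front T1 d s).
pose al s := expR (- l * s).
pose ga s := - (al s * B s).
pose dal s := - l * al s.
pose dga s := al s * B s * (l + a * dfront T1 d s).
have Dal (s : R) : is_derive s (1 : R) al (dal s).
  by apply: is_derive_eq; rewrite /dal/al/GRing.scale/=; ring.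
have Dga (s : R) : is_derive s (1 : R) ga (dga s).
  have Df := is_derive_front T1 d s.
  by apply: is_derive_eq; rewrite /dga/dal/al/B/GRing.scale/=; ring.
have cal : continuous al.
  move=> s; apply: differentiable_continuous; apply/derivable1_diffP.
  by have [] := Dal s.
have cga : continuous ga.
  move=> s; apply: differentiable_continuous; apply/derivable1_diffP.
  by have [] := Dga s.
have cdal : continuous dal by move=> s; apply: cvgM; [exact: cvg_cst | exact: cal].
have cdga : continuous dga.
  rewrite (_ : dga = fun s => - ga s * (l + a * dfront T1 d s)); last first.
    by apply/funext => s; rewrite /ga opprK.
  move=> s; apply: cvgM; first exact: (cvgN (cga s)).
  apply: cvgD; first exact: cvg_cst.
  by apply: cvgM; [exact: cvg_cst | exact: continuous_dfront].
have Bge s : 0 <= s -> expR (- a) <= B s.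
  by move=> /(front_bounds T1 d hT1 d0 d1 _)/andP[_ f1]; rewrite ler_expR; nra.
have phi_le : forall p, para_cylinder T p -> radial a al ga p <= u p.
  apply: (comparison _ T0 _ _ _ _ usol).
  - by move=> p; exact: (C21_radial a Dal Dga cdal cdga).
  - move=> p bp; have u0 := u_bdry p bp; move: bp u0.
    case: p => y s [[/= y1 ->]|[/= y1 /andP[s0 sT]]] u0.
      rewrite /radial/ga/al/B/= mulr0 expR0 !mul1r front0.
      have B0 := expR_gt0 (- a * d).
      have [yd|yd] := leP (euclid_norm y) delta.
        apply: le_trans (u_init y yd).
        have E1 : expR (- a * sqnorm y) <= 1.
          by rewrite -expR0 ler_expR; have := sqnorm_ge0 y; nra.
        lra.
      apply: le_trans u0; rewrite subr_le0 ler_expR.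
      suff : d <= sqnorm y by nra.
      by rewrite /d -sqr_euclid_norm ler_pXn2r ?nnegrE ?euclid_norm_ge0// ltW.
    apply: le_trans u0.
    rewrite /radial/ga/= -sqr_euclid_norm y1 expr1n mulr1 subr_le0.
    by rewrite ler_pM2l ?expR_gt0 ?Bge.
  - move=> p Dp; have [low|high] := leP (radial a al ga p) (- (2 * kappa * T)).
      by left; exact: le_trans low (u_lower p Dp).
    right; apply: le_lt_trans.
      apply: (radial_operator_le a Dal Dga K p (ltW hK) (ltW a0)).
      exact: expR_ge0.
    case: p Dp high => y s [/= y1 /andP[s0 sT]] high.
    have /andP[df _] := front_bounds T1 d hT1 d0 d1 s (ltW s0).
    have strict := barrier_strict K n%:R T (2 / T1) d a l kappa (al s) (B s)
      (dfront T1 d s) (sqnorm y) s.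
    rewrite /dal/dga/= -[_ * al s * _]mulrA. apply: strict => //.
    + by rewrite sqnorm_ge0 -euclid_norm_le1 ltW.
    + by rewrite sT ltW.
    + by rewrite expR_gt0 ler_expR; nra.
    + exact: dfront_bounds (ltW s0).
have Dxt : para_cylinder T (x, t) by split => //=; rewrite tT (lt_le_trans hT1).
apply: le_trans (phi_le _ Dxt).
have := euclid_dist_sphere_le x hn x1.
have r1 : euclid_norm x < 1 := x1.
have r0 := euclid_norm_ge0 x.
set r := euclid_norm x in r0 r1 * => dist_le.
have e0 := expR_gt0 (- l * T - a).
apply: le_trans (_ : a * expR (- l * T - a) * (1 - r) <= _).
  by rewrite ler_wpM2l// mulr_ge0// ltW.
rewrite /radial/ga/B/= front_eq1// mulr1 -mulrBr -sqr_euclid_norm -/r.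
have r01 : 0 <= r <= 1 by rewrite r0 ltW.
have growth := expR_sqr_slope a r (ltW a0) r01.
rewrite (_ : a * _ * _ = expR (- l * T) * (expR (- a) * (a * (1 - r)))); last first.
  by rewrite expRD; ring.
apply: ler_pM => //; rewrite ?expR_ge0//.
  by rewrite !mulr_ge0 ?expR_ge0 ?(ltW a0)// subr_ge0 ltW.
by rewrite ler_expR; nra.
Qed.
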